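(* For every nonempty (i.e. having at least one vertex) finite simple graph $G$, \[ \overline{\vartheta}(M(G)) = \frac43\overline{\vartheta}(G)\cos\left(\frac13\arccos\left(1-\frac{27}{4\overline{\vartheta}(G)}+\frac{27}{4\overline{\vartheta}(G)^2}\right)\right)-\frac13\overline{\vartheta}(G)+1. \]
   Context: For a simple graph $G$ on vertex set $V$, a dual orthonormal representation assigns to each $i\in V$ a unit vector $u_i\in\mathbb{R}^d$ (some $d$) such that $\langle u_i,u_j\rangle=0$ whenever $i\neq j$ and $\{i,j\}\in E(G)$. The complementary Lovász theta number is $\overline{\vartheta}(G)=\min\max_{i\in V}\frac{1}{\langle c,u_i\rangle^2}$, the minimum taken over all dual orthonormal representations $(u_i)$ of $G$ in any dimension $d$ and all unit vectors $c\in\mathbb{R}^d$. The Mycielskian $M(G)$ has vertex set $V(G)\times\{0,1\}\cup\{z\}$ ($z$ a new vertex) and edge set $\{\{(v,0),(w,i)\}:\{v,w\}\in E(G),\ i\in\{0,1\}\}\cup\{\{z,(v,1)\}: v\in V(G)\}$. *)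

(* Defs.v *)
From HB Require Import structures.
From mathcomp Require Import all_boot all_order all_algebra.
From mathcomp Require Import all_classical all_reals all_analysis.

Set Implicit Arguments.
Unset Strict Implicit.
Unset Printing Implicit Defensive.

Import Order.TTheory GRing.Theory Num.Theory.
Local Open Scope classical_set_scope.
Local Open Scope ring_scope.

Record sgraph := SGraph {
  vertex :> finType;
  adj : rel vertex;
  adj_sym : symmetric adj;
  adj_irrefl : irreflexive adj }.

(* [None] is the new vertex z, [Some (v, false)] is (v, 0) and
   [Some (v, true)] is (v, 1). *)
Definition mycielski_adj (G : sgraph) : rel (option (G * bool)) :=
  fun x y =>
    match x, y with
    | Some (v, i), Some (w, j) => adj v w && (~~ i || ~~ j)
    | None, Some (_, j) => j
    | Some (_, i), None => i
    | None, None => false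
    end.

Lemma mycielski_adj_sym (G : sgraph) : symmetric (@mycielski_adj G).
Proof. by move=> [[v i]|] [[w j]|] //=; rewrite adj_sym orbC. Qed.

Lemma mycielski_adj_irrefl (G : sgraph) : irreflexive (@mycielski_adj G).
Proof. by move=> [[v i]|] //=; rewrite adj_irrefl. Qed.

Definition mycielskian (G : sgraph) : sgraph :=
  {| vertex := option (G * bool);
     adj := @mycielski_adj G;
     adj_sym := @mycielski_adj_sym G;
     adj_irrefl := @mycielski_adj_irrefl G |}.

Definition dotv (R : realType) (d : nat) (u v : 'rV[R]_d) : R :=
  \sum_(k < d) u 0 k * v 0 k.

Definition dual_orthonormal_rep (R : realType) (G : sgraph) (d : nat)
    (u : G -> 'rV[R]_d) : Prop :=
  (forall i : G, dotv (u i) (u i) = 1) /\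
  (forall i j : G, i != j -> adj i j -> dotv (u i) (u j) = 0).

(* The values of max_i 1 / <c, u_i>^2.  Pairs with some <c, u_i> = 0 have value
   +oo and never attain the minimum; they are left out because 0^-1 = 0 in R.
   The terms are positive, so the base value 0 of the iterated maximum is
   harmless when G has a vertex. *)
Definition theta_bar_values (R : realType) (G : sgraph) : set R :=
  [set t | exists d : nat, exists u : G -> 'rV[R]_d, exists c : 'rV[R]_d,
    [/\ dual_orthonormal_rep u,
        dotv c c = 1,
        (forall i : G, dotv c (u i) != 0) &
        t = \big[Num.max/0]_(i : G) (1 / dotv c (u i) ^+ 2)]].

(* For G with a vertex the infimum is attained: one may take d <= #|G| + 1, and
   the configurations then form a compact set. *)
Definition theta_bar (R : realType) (G : sgraph) : R :=
  inf (@theta_bar_values R G).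

(* Main.v *)
Require Import Defs.
From mathcomp Require Import all_boot all_order all_algebra.
From mathcomp Require Import ring lra.
From mathcomp Require Import all_classical all_reals all_analysis.

Set Implicit Arguments.
Unset Strict Implicit.
Unset Printing Implicit Defensive.

Import Order.TTheory GRing.Theory Num.Theory.
Import numFieldNormedType.Exports.
Local Open Scope ring_scope.

(** Write t for the theta number of G and 1 + s for the claimed value for M(G).
    The trigonometric formula says that s is the root in [t/3, t] of
    (s + t)^2 (t - s) = 4 t (t - 1).

    Semidefinite duality: let t be the maximum of the sum of the entries of B over
    positive semidefinite B of trace 1 supported on the diagonal and the edges.
    Minimising the distance of a Gram matrix to the required entries produces
    vectors y_v with |y_v|^2 = t - 1 and <y_u, y_v> = -1 on edges. Rescaling an
    optimal B by its diagonal produces A with 0 <= A <= t, unit diagonal on the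
    support of a unit vector psi, and A psi = t psi.

    Upper bound: with c, e, y orthogonal, use c - sqrt s e for z,
    c - b e + g y_v for (v, 0) and c + a e + k y_v for (v, 1).

    Lower bound: scale a representation of M(G) so that all vectors have inner
    product 1 with c, and let W, X be the matrices with rows psi_v w_(v,0),
    psi_v w_(v,1). Orthogonality gives <W, A W> = |W|^2 and <X, A W> = <X, W>.
    Removing the psi-components, Cauchy-Schwarz for X and A W - W together with
    A^2 <= t A bounds the means W^T psi and X^T psi, and these constraints force
    the cubic inequality. *)

(** * The cubic relating [s] to [t], and its trigonometric root *)

Section MycielskiCubic.
Variable R : realType.
Implicit Types s t : R.

Lemma eq_of_sqr_ge0 (x y : R) : 0 <= x -> 0 <= y -> x ^+ 2 = y ^+ 2 -> x = y.
Proof.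
move=> x0 y0 /eqP; rewrite eqf_sqr => /orP[/eqP//|/eqP xNy].
by lra.
Qed.

Lemma le_of_sqr_ge0 (x y : R) : 0 <= y -> x ^+ 2 <= y ^+ 2 -> x <= y.
Proof. move=> y0 xy; have [//|yx] := leP x y; nra. Qed.

(** Beyond [t / 3] the left side of the cubic decreases in [s], and at [s = t - 1] it equals
    [4 t (t - 1) + 1], which is too large. *)
Lemma cubic_root_ge t s : 1 <= t -> t / 3 <= s ->
  (s + t) ^+ 2 * (t - s) = 4 * t * (t - 1) -> t - 1 <= s.
Proof.
move=> t1 ts E; rewrite leNgt; apply/negP => st.
have : 0 < (t - 1 - s) * (t * (s + (t - 1)) + (s ^+ 2 + s * (t - 1) + (t - 1) ^+ 2) - t ^+ 2).
  apply: mulr_gt0; first lra.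
  have : t / 3 < t - 1 by lra.
  nra.
nra.
Qed.

(** By the same monotonicity, the cubic inequality can hold beyond [t / 3] only past the root. *)
Lemma cubic_root_le t s s' : 1 <= t -> t / 3 <= s' ->
  (s + t) ^+ 2 * (t - s) = 4 * t * (t - 1) ->
  (s' + t) ^+ 2 * (t - s') <= 4 * t * (t - 1) -> s <= s'.
Proof.
move=> t1 ts' E E'; rewrite leNgt; apply/negP => s's.
have : 0 < (s - s') * (t * (s + s') + (s ^+ 2 + s * s' + s' ^+ 2) - t ^+ 2).
  apply: mulr_gt0; first lra.
  nra.
nra.
Qed.

(** With [p = b a] from the upper bound construction, this makes the vectors of (v, 1) have squared
    length exactly [1 + s]. *)
Lemma cubic_root_weight t s (p : R) : 1 <= t -> t - 1 <= s -> s <= t -> 0 < s ->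
  0 <= p -> p ^+ 2 * (t * s) = 1 + s - t ->
  (s + t) ^+ 2 * (t - s) = 4 * t * (t - 1) ->
  (t - 1) * (1 - p) ^+ 2 * (t * s) = (s ^+ 2 - 1) * (1 + s).
Proof.
move=> t1 s1 st s0 p0 pE E.
(* In these variables the cubic is only quadratic in [m]: [d m^2 - 2 d m + d^2 - 1 = 0]. *)
pose d := 1 + s - t; pose m := s + t.
have dE : d = 1 + s - t by [].
have mE : m = s + t by [].
have h0 : d * m ^+ 2 - 2 * d * m + d ^+ 2 - 1 = 0 by rewrite dE mE; nra.
(* Both sides are nonnegative, and once [p^2] is eliminated the difference of their squares is a
   multiple of the cubic. *)
have x1 : m * (1 - d ^+ 2) = (m - 1 - d) * (2 * (p * (t * s))).
  apply: eq_of_sqr_ge0.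
  - by apply: mulr_ge0; [lra|nra].
  - by apply: mulr_ge0; [lra|apply: mulr_ge0=> //; apply: mulr_ge0 => //; nra].
  have -> : ((m - 1 - d) * (2 * (p * (t * s)))) ^+ 2 =
     (m - 1 - d) ^+ 2 * (4 * (p ^+ 2 * (t * s)) * (t * s)) by ring.
  rewrite pE -dE.
  have e : (m * (1 - d ^+ 2)) ^+ 2 - (m - 1 - d) ^+ 2 * (4 * d * (t * s)) =
    - (d * m ^+ 2 - 2 * d * m + d ^+ 2 - 1) * (m ^+ 2 - 2 * d * m + d * (1 - d ^+ 2)).
    rewrite dE mE; ring.
  by apply/eqP; rewrite -subr_eq0 e h0 oppr0 mul0r.
have -> : (t - 1) * (1 - p) ^+ 2 * (t * s) =
  (t - 1) * (t * s + p ^+ 2 * (t * s)) - 2 * (t - 1) * (p * (t * s)) by ring.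
rewrite pE.
have -> : 2 * (t - 1) * (p * (t * s)) = (m - 1 - d) * (2 * (p * (t * s))) / 2.
  by rewrite mE dE; field.
rewrite -x1; apply/eqP; rewrite -subr_eq0; apply/eqP.
transitivity (- (d * m ^+ 2 - 2 * d * m + d ^+ 2 - 1) / 2); last by rewrite h0 oppr0 mul0r.
by rewrite dE mE; field.
Qed.

(** Fixes the sign of the slope at the corner in [cubic_bound], where it becomes [s b0 <= e0]. In
    terms of [d = 1 + s - t], failure of the cubic bound reads [d (2 s - d)^2 < 1 + d - d^2]. *)
Lemma cubic_slope t s : 1 <= t -> t - 1 <= s -> s < t ->
  4 * t * (t - 1) < (s + t) ^+ 2 * (t - s) -> s ^+ 3 * (1 + s - t) <= t.
Proof.
move=> t1 s1 st hneg; pose d := 1 + s - t.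
have dE : d = 1 + s - t by [].
have tE : t = 1 + s - d by rewrite dE; ring.
have k1 : d * (2 * s - d) ^+ 2 < 1 + d - d ^+ 2.
  by rewrite dE; move: hneg; clear; nra.
have d0 : 0 <= d by lra.
have d1 : d < 1 by lra.
have sd : d <= s by lra.
rewrite -dE {}tE; clear - k1 d0 d1 sd.
(* Otherwise [d (2 s - d) >= 1], although its square is below [d (1 + d - d^2) <= 1]. *)
have sd1 : s * d <= 1.
  rewrite leNgt; apply/negP => sd1.
  have dp : 0 < d by nra.
  have k2 : 1 <= d * (2 * s - d) by nra.
  have k3 : 1 <= (d * (2 * s - d)) ^+ 2 by rewrite expr_ge1 //; lra.
  have k4 : (d * (2 * s - d)) ^+ 2 < d * (1 + d - d ^+ 2).
    have -> : (d * (2 * s - d)) ^+ 2 = d * (d * (2 * s - d) ^+ 2) by ring.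
    by rewrite ltr_pM2l.
  have : 0 <= (1 - d) ^+ 2 * (1 + d) by apply: mulr_ge0; [exact: sqr_ge0|lra].
  nra.
have k2 : d * s ^+ 2 <= 1 + d - d ^+ 2.
  apply: le_trans (ltW k1); apply: ler_wpM2l => //.
  by rewrite ler_pXn2r ?nnegrE //; lra.
have s0 : 0 <= s by lra.
have -> : s ^+ 3 * d = s * (d * s ^+ 2) by ring.
apply: (le_trans (ler_wpM2l s0 k2)).
have : 0 <= (1 - s * d) * (1 - d) by apply: mulr_ge0; lra.
nra.
Qed.

(** Runs the computation of [cubic_root_weight] with inequalities: were the cubic bound false, the
    hypothesis would put [m (1 - d^2)] strictly below [2 (m - 1 - d) p t s], while comparing squares
    gives the reverse. *)
Lemma cubic_corner t s (p : R) : 1 <= t -> t - 1 <= s -> s < t -> 0 < s ->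
  0 <= p -> p ^+ 2 * (t * s) = 1 + s - t ->
  (t - 1) * (1 - p) ^+ 2 * (t * s) <= (s ^+ 2 - 1) * (1 + s) ->
  (s + t) ^+ 2 * (t - s) <= 4 * t * (t - 1).
Proof.
move=> t1 s1 st s0 p0 pE H; rewrite leNgt; apply/negP => hneg.
pose d := 1 + s - t; pose m := s + t.
have dE : d = 1 + s - t by [].
have mE : m = s + t by [].
have h0 : d * m ^+ 2 - 2 * d * m + d ^+ 2 - 1 < 0.
  by rewrite dE mE; move: hneg; clear; nra.
have g0 : m * (1 - d ^+ 2) <=
    (m - 1 - d) * (2 * (p * (t * s))) + (d * m ^+ 2 - 2 * d * m + d ^+ 2 - 1).
  rewrite -subr_ge0 [leRHS](_ : _ = 2 * ((s ^+ 2 - 1) * (1 + s)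
    - ((t - 1) * (t * s + (1 + s - t)) - 2 * (t - 1) * (p * (t * s))))); last first.
    by rewrite mE dE; ring.
  rewrite -pE mulr_ge0 // subr_ge0; apply: le_trans H.
  by rewrite le_eqVlt; apply/orP; left; apply/eqP; ring.
have : m * (1 - d ^+ 2) < (m - 1 - d) * (2 * (p * (t * s))) by lra.
rewrite ltNge => /negP; apply.
have d0 : 0 <= d by lra.
have d1 : d < 1 by lra.
have md : 1 + d <= m by lra.
apply: le_of_sqr_ge0.
  by apply: mulr_ge0; [lra|clear - d0 d1; nra].
have -> : ((m - 1 - d) * (2 * (p * (t * s)))) ^+ 2 =
   (m - 1 - d) ^+ 2 * (4 * (p ^+ 2 * (t * s)) * (t * s)) by ring.
rewrite pE -subr_ge0.
rewrite [leRHS](_ : _ =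
  - (d * m ^+ 2 - 2 * d * m + d ^+ 2 - 1) * (m ^+ 2 - 2 * d * m + d * (1 - d ^+ 2))); last first.
  by rewrite dE mE; ring.
apply: mulr_ge0; first lra.
apply: addr_ge0; last by apply: mulr_ge0 => //; clear - d0 d1; nra.
rewrite (_ : _ - _ = m * (m - 2 * d)); last ring.
by apply: mulr_ge0; lra.
Qed.

(* The constraint is a convex quadratic in b = sqrt (w - 1), e = sqrt (x - 1); on
   the feasible quadrant it is least at the corner b0^2 = (1 + s - t) / t,
   e0^2 = 1 / s, where it reduces to the cubic. *)
Lemma cubic_bound t s (w x z : R) : 1 <= t -> 0 < s ->
  1 <= w -> t * w <= 1 + s -> 1 <= s * (x - 1) -> x <= 1 + s ->
  (z - 1) ^+ 2 <= (w - 1) * (x - 1) ->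
  (t - 1) * z ^+ 2 <= (1 + s - x) * (1 + s - (t - 1) * w) ->
  (s + t) ^+ 2 * (t - s) <= 4 * t * (t - 1).
Proof.
move=> t1 s0 w1 tw sx xs zwx H.
have [ts|st] := leP t s.
  apply: (@le_trans _ _ 0); last by apply: mulr_ge0; lra.
  by apply: mulr_ge0_le0; [exact: sqr_ge0|lra].
have x1 : 0 <= x - 1 by nra.
pose d := 1 + s - t.
have dE : d = 1 + s - t by [].
have d0 : 0 <= d by rewrite dE; nra.
have t0 : 0 < t by lra.
pose b := Num.sqrt (w - 1); pose e := Num.sqrt (x - 1).
have b0 : 0 <= b by exact: sqrtr_ge0.
have e0 : 0 <= e by exact: sqrtr_ge0.
have bE : b ^+ 2 = w - 1 by rewrite sqr_sqrtr //; lra.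
have eE : e ^+ 2 = x - 1 by rewrite sqr_sqrtr.
pose b' := Num.sqrt (d / t); pose e' := Num.sqrt (1 / s).
have b'0 : 0 <= b' by exact: sqrtr_ge0.
have e'0 : 0 <= e' by exact: sqrtr_ge0.
have b'E : b' ^+ 2 * t = d.
  by rewrite sqr_sqrtr ?divr_ge0 ?(ltW t0)// divfK// gt_eqF.
have e'E : e' ^+ 2 * s = 1.
  by rewrite sqr_sqrtr ?divr_ge0 ?(ltW s0)// divfK// gt_eqF.
have bb' : b <= b'.
  apply: le_of_sqr_ge0 => //.
  rewrite -(ler_pM2r t0) b'E bE dE; nra.
have ee' : e' <= e.
  apply: le_of_sqr_ge0 => //.
  by rewrite -(ler_pM2r s0) e'E eE mulrC.
have be1 : b * e <= 1.
  apply: le_of_sqr_ge0 => //; rewrite exprMn bE eE expr1n.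
  rewrite -(ler_pM2r t0); nra.
have zbe : 1 - b * e <= z.
  have : 1 - z <= b * e.
    apply: le_of_sqr_ge0; first exact: mulr_ge0.
    rewrite exprMn bE eE; apply: le_trans zwx; rewrite le_eqVlt; apply/orP; left; apply/eqP; ring.
  lra.
have z2 : (1 - b * e) ^+ 2 <= z ^+ 2.
  by rewrite ler_pXn2r ?nnegrE //; lra.
(* With [z] replaced by [1 - b e], the terms in [b^2 e^2] cancel and a quadratic in [b], [e]
   remains. *)
have S0 : 0 <= s * (2 + s - t) - (t - 1)
    - (s * (t - 1) * b ^+ 2 - 2 * (t - 1) * (b * e) + (2 + s - t) * e ^+ 2).
  have : (t - 1) * (1 - b * e) ^+ 2 <= (1 + s - x) * (1 + s - (t - 1) * w).
    apply: le_trans H; apply: ler_wpM2l => //; lra.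
  have -> : x = 1 + e ^+ 2 by lra.
  have -> : w = 1 + b ^+ 2 by lra.
  nra.
have s1 : t - 1 <= s by lra.
rewrite leNgt; apply/negP => hneg.
have sdt := cubic_slope t1 s1 st hneg.
clear - R t s t1 s0 s1 st hneg d dE t0 b e b0 e0 b' e' b'0 e'0 b'E e'E bb' ee' S0 sdt.
have kb : s * b' <= e'.
  apply: le_of_sqr_ge0 => //; rewrite exprMn.
  rewrite -(ler_pM2r s0) e'E -(ler_pM2r t0) mul1r.
  have -> : s ^+ 2 * b' ^+ 2 * s * t = s ^+ 3 * (b' ^+ 2 * t) by ring.
  by rewrite b'E.
have ke : (t - 1) * b' <= (2 + s - t) * e'.
  apply: (@le_trans _ _ (s * b')); first by apply: ler_wpM2r => //; lra.
  apply: (le_trans kb); rewrite ler_peMl //; lra.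
have S1 : 0 <= s * (2 + s - t) - (t - 1)
    - (s * (t - 1) * b' ^+ 2 - 2 * (t - 1) * (b' * e') + (2 + s - t) * e' ^+ 2).
  apply: (le_trans S0); rewrite lerB // -subr_ge0.
  (* Taylor expansion at the corner: the quadratic form of the displacement, written as a sum of
     squares, plus the two slope terms, whose signs come from [bb'], [ee'], [kb] and [ke]. *)
  rewrite [leRHS](_ : _ =
    ((t - 1) * (s * (b - b') - (e - e')) ^+ 2 + (1 + s) * (1 + s - t) * (e - e') ^+ 2) / s
    + (2 * ((t - 1) * ((e' - s * b') * (b' - b)))
    + 2 * (((2 + s - t) * e' - (t - 1) * b') * (e - e')))); last first.
    by field; rewrite gt_eqF.
  apply: addr_ge0.
    apply: divr_ge0; last exact: ltW.
    by apply: addr_ge0; apply: mulr_ge0; rewrite ?sqr_ge0 //; [lra|apply: mulr_ge0; lra].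
  apply: addr_ge0.
    apply: mulr_ge0 => //; apply: mulr_ge0; first lra.
    by apply: mulr_ge0; lra.
  by apply: mulr_ge0 => //; apply: mulr_ge0; lra.
move: hneg; rewrite ltNge => /negP; apply.
apply: (@cubic_corner t s (b' * e')) => //; first exact: mulr_ge0.
  by rewrite exprMn mulrACA b'E e'E mulr1.
rewrite -subr_ge0 [leRHS](_ : _ = (s * (2 + s - t) - (t - 1)
    - (s * (t - 1) * b' ^+ 2 - 2 * (t - 1) * (b' * e') + (2 + s - t) * e' ^+ 2)) * (t * s)).
  by apply: mulr_ge0 => //; apply: mulr_ge0; lra.
transitivity ((s ^+ 2 - 1) * (1 + s) - (t - 1) * (t * s + (b' ^+ 2 * t) * (e' ^+ 2 * s)
   - 2 * (b' * e') * (t * s))); first by ring.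
transitivity ((s * (2 + s - t) - (t - 1)) * (t * s) - s ^+ 2 * (t - 1) * (b' ^+ 2 * t)
    + 2 * (t - 1) * (b' * e' * (t * s)) - (2 + s - t) * t * (e' ^+ 2 * s)); last by ring.
by rewrite b'E e'E dE; ring.
Qed.

Lemma cos3 (x : R) : cos (3 * x) = 4 * cos x ^+ 3 - 3 * cos x.
Proof.
have -> : 3 * x = x *+ 2 + x by ring.
have := cos2Dsin2 x.
rewrite cosD cos_mulr2n sin_mulr2n => E.
have -> : (cos x * sin x) *+ 2 * sin x = 2 * cos x * (1 - cos x ^+ 2).
  have -> : 1 - cos x ^+ 2 = sin x ^+ 2 by lra.
  by ring.
by ring.
Qed.

Lemma cos_pi3 : cos (pi / 3) = 1 / 2 :> R.
Proof.
have c0 : 0 < cos (pi / 3 : R).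
  apply: cos_gt0_pihalf; have := pi_gt0 R; lra.
have := cos3 (pi / 3); rewrite mulrC divfK // cospi => E.
(* Factorisation of [4 x^3 - 3 x + 1], which vanishes at this cosine by the triple angle formula. *)
have /eqP : (2 * cos (pi / 3 : R) - 1) ^+ 2 * (cos (pi / 3) + 1) = 0.
  apply/eqP; rewrite -subr_eq0; apply/eqP.
  transitivity (4 * cos (pi / 3 : R) ^+ 3 - 3 * cos (pi / 3) - (-1)); first ring.
  by rewrite -E subrr.
rewrite mulf_eq0 expf_eq0 /= => /orP[|]; first by move/eqP; lra.
by move/eqP; lra.
Qed.

(** Viète's trigonometric solution: substituting [s = (4 t cos x - t) / 3] turns the cubic into a
    prescribed value of [cos (3 x)]. *)
Definition mycielski_root t : R :=
  4 / 3 * t * cos (1 / 3 * acos (1 - 27 / (4 * t) + 27 / (4 * t ^+ 2))) - 1 / 3 * t.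

Lemma mycielski_rootP t (s := mycielski_root t) : 1 <= t ->
  [/\ t / 3 <= s, s <= t & (s + t) ^+ 2 * (t - s) = 4 * t * (t - 1)].
Proof.
move=> t1; rewrite /s /mycielski_root; set y := 1 - _ + _.
have t0 : t != 0 by rewrite gt_eqF //; lra.
have t2 : 0 < 4 * t ^+ 2 by rewrite mulr_gt0 // exprn_gt0 //; lra.
have yE : y * (4 * t ^+ 2) = 4 * t ^+ 2 - 27 * (t - 1) by rewrite /y; field.
have y1 : -1 <= y <= 1.
  apply/andP; split; rewrite -(ler_pM2r t2) yE; last by nra.
  (* [8 t^2 - 27 (t - 1)] has its vertex at [27 / 16] and is positive there. *)
  have := sqr_ge0 (t - 27 / 16); nra.
set x := 1 / 3 * acos y.
have x3 : cos (3 * x) = y.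
  by rewrite /x mulrA mul1r divff // mul1r acosK // in_itv.
have x0 : 0 <= x by rewrite /x; have := acos_ge0 y1; lra.
have xpi : x <= pi / 3 by rewrite /x; have := acos_lepi y1; lra.
have c1 := cos_le1 x.
have pi0 := pi_gt0 R.
(* This choice of branch is what gives [t / 3 <= s]. *)
have c2 : 1 / 2 <= cos x.
  by rewrite -cos_pi3 leNgt ltr_cos ?in_itv /= -?leNgt //; apply/andP; split; lra.
move: x3; rewrite cos3 => x3.
split; [nra|nra|].
have {x3}yE : (4 * cos x ^+ 3 - 3 * cos x) * (4 * t ^+ 2) = 4 * t ^+ 2 - 27 * (t - 1).
  by rewrite x3.
transitivity (t * (16 / 27 * t ^+ 2 * (1 - (4 * cos x ^+ 3 - 3 * cos x)))).
  by field.
transitivity (4 / 27 * t * (4 * t ^+ 2 - (4 * cos x ^+ 3 - 3 * cos x) * (4 * t ^+ 2))).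
  by field.
by rewrite yE; field.
Qed.

End MycielskiCubic.

(** * The trace inner product and positive semidefinite matrices *)

Section MxDot.
Variable R : realType.

Definition mxdot m n (X Y : 'M[R]_(m, n)) : R := \tr (X^T *m Y).

Section Theory.
Variables m n : nat.
Implicit Types X Y Z : 'M[R]_(m, n).

Lemma mxdotE X Y : mxdot X Y = \sum_i \sum_j X i j * Y i j.
Proof.
rewrite exchange_big; apply: eq_bigr => j _.
by rewrite mxE; apply: eq_bigr => i _; rewrite mxE.
Qed.

Lemma mxdotC X Y : mxdot X Y = mxdot Y X.
Proof. by rewrite /mxdot -mxtrace_tr trmx_mul trmxK. Qed.

Lemma mxdotDl X Y Z : mxdot (X + Y) Z = mxdot X Z + mxdot Y Z.
Proof. by rewrite /mxdot linearD mulmxDl mxtraceD. Qed.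

Lemma mxdotDr X Y Z : mxdot Z (X + Y) = mxdot Z X + mxdot Z Y.
Proof. by rewrite /mxdot mulmxDr mxtraceD. Qed.

Lemma mxdotZl a X Y : mxdot (a *: X) Y = a * mxdot X Y.
Proof. by rewrite /mxdot linearZ /= -scalemxAl mxtraceZ. Qed.

Lemma mxdotZr a X Y : mxdot X (a *: Y) = a * mxdot X Y.
Proof. by rewrite mxdotC mxdotZl mxdotC. Qed.

Lemma mxdotNl X Y : mxdot (- X) Y = - mxdot X Y.
Proof. by rewrite -scaleN1r mxdotZl mulN1r. Qed.

Lemma mxdotNr X Y : mxdot X (- Y) = - mxdot X Y.
Proof. by rewrite mxdotC mxdotNl mxdotC. Qed.

Lemma mxdotBl X Y Z : mxdot (X - Y) Z = mxdot X Z - mxdot Y Z.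
Proof. by rewrite mxdotDl mxdotNl. Qed.

Lemma mxdotBr X Y Z : mxdot Z (X - Y) = mxdot Z X - mxdot Z Y.
Proof. by rewrite mxdotDr mxdotNr. Qed.

Lemma mxdot_ge0 X : 0 <= mxdot X X.
Proof.
by rewrite mxdotE; apply: sumr_ge0 => i _; apply: sumr_ge0 => j _; rewrite -expr2 sqr_ge0.
Qed.

Lemma mxdot_eq0 X : mxdot X X = 0 -> X = 0.
Proof.
rewrite mxdotE => /eqP; rewrite psumr_eq0 => [|i _]; last first.
  by apply: sumr_ge0 => j _; rewrite -expr2 sqr_ge0.
move=> /allP X0; apply/matrixP => i j; rewrite mxE; apply/eqP.
have := X0 i (mem_index_enum i); rewrite psumr_eq0 => [|k _]; last first.
  by rewrite -expr2 sqr_ge0.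
by move=> /allP /(_ j (mem_index_enum j)); rewrite -expr2 sqrf_eq0.
Qed.

End Theory.

Lemma mxdot_mull m n p (A : 'M[R]_(m, n)) (X : 'M[R]_(n, p)) Y :
  mxdot (A *m X) Y = mxdot X (A^T *m Y).
Proof. by rewrite /mxdot trmx_mul mulmxA. Qed.

Lemma mxdot_mulr m n p (A : 'M[R]_(n, p)) (X : 'M[R]_(m, n)) Y :
  mxdot (X *m A) Y = mxdot X (Y *m A^T).
Proof. by rewrite /mxdot trmx_mul -mulmxA mxtrace_mulC mulmxA. Qed.

Lemma mxdot_tr m n (X Y : 'M[R]_(m, n)) : mxdot X^T Y^T = mxdot X Y.
Proof. by rewrite /mxdot trmxK mxtrace_mulC -mxtrace_tr trmx_mul trmxK. Qed.

Lemma mxdot_col m n (X Y : 'M[R]_(m, n)) :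
  mxdot X Y = \sum_j mxdot (col j X) (col j Y).
Proof.
rewrite mxdotE exchange_big; apply: eq_bigr => j _.
by rewrite mxdotE; apply: eq_bigr => i _; rewrite big_ord1 !mxE.
Qed.

Lemma discriminant_le (a b c : R) : 0 <= c ->
  (forall k, 0 <= a + 2 * k * b + k ^+ 2 * c) -> b ^+ 2 <= a * c.
Proof.
move=> c_ge0 H; have [c0|c0] := eqVneq c 0.
  have [->|b0] := eqVneq b 0; first by rewrite c0 mulr0 expr0n.
  (* For [c = 0] this [k] brings the form down to -1. *)
  have := H (- (a + 1) / (2 * b)); rewrite c0 mulr0 addr0.
  have -> : 2 * (- (a + 1) / (2 * b)) * b = - (a + 1) by field.
  lra.
have c1 : 0 < c by rewrite lt_neqAle eq_sym c0.
have := H (- b / c); rewrite -(ler_pM2r c1) mul0r.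
have -> : (a + 2 * (- b / c) * b + (- b / c) ^+ 2 * c) * c = a * c - b ^+ 2 by field.
by rewrite subr_ge0.
Qed.

Definition psdmx n (A : 'M[R]_n) : Prop :=
  A^T = A /\ forall x : 'cV[R]_n, 0 <= mxdot x (A *m x).

Lemma psdmx1 n : psdmx (1%:M : 'M[R]_n).
Proof. by split=> [|x]; rewrite ?trmx1 // mul1mx mxdot_ge0. Qed.

Section Psd.
Variables (n : nat) (A : 'M[R]_n).
Hypothesis psdA : psdmx A.

Lemma psdmx_ge0 d (X : 'M[R]_(n, d)) : 0 <= mxdot X (A *m X).
Proof.
rewrite mxdot_col; apply: sumr_ge0 => j _.
by rewrite !colE -mulmxA; apply: psdA.2.
Qed.

Lemma psdmx_sym d (X Y : 'M[R]_(n, d)) : mxdot X (A *m Y) = mxdot Y (A *m X).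
Proof. by rewrite mxdotC mxdot_mull psdA.1. Qed.

Lemma psdmx_CauchySchwarz d (X Y : 'M[R]_(n, d)) :
  mxdot X (A *m Y) ^+ 2 <= mxdot X (A *m X) * mxdot Y (A *m Y).
Proof.
apply: discriminant_le => [|k]; first exact: psdmx_ge0.
 apply: le_trans (psdmx_ge0 (X + k *: Y)) _.
rewrite mulmxDr -scalemxAr !mxdotDl !mxdotDr !mxdotZl !mxdotZr (psdmx_sym Y X).
by rewrite le_eqVlt; apply/orP; left; apply/eqP; ring.
Qed.

Lemma psdmx_ker d (X : 'M[R]_(n, d)) : mxdot X (A *m X) = 0 -> A *m X = 0.
Proof.
move=> X0; apply: mxdot_eq0; apply/eqP; rewrite -sqrf_eq0 eq_le sqr_ge0 andbT.
by apply: le_trans (psdmx_CauchySchwarz _ _) _; rewrite X0 mulr0.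
Qed.

(* Cauchy-Schwarz for the form A, between A X and X. *)
Lemma psdmx_sqr_le (t : R) d (X : 'M[R]_(n, d)) : 0 <= t ->
  (forall x : 'cV[R]_n, mxdot x (A *m x) <= t * mxdot x x) ->
  mxdot (A *m X) (A *m X) <= t * mxdot X (A *m X).
Proof.
move=> t0 At; set Y := A *m X.
have := psdmx_CauchySchwarz Y X; rewrite -/Y.
have : mxdot Y (A *m Y) <= t * mxdot Y Y.
  rewrite mxdot_col [X in _ * X]mxdot_col mulr_sumr; apply: ler_sum => j _.
  by rewrite !colE -mulmxA.
have := mxdot_ge0 Y; have := psdmx_ge0 X; rewrite -/Y.
set a := mxdot Y Y; set b := mxdot X Y; set c := mxdot Y _ => b0 a0 ca abc.
have abc' : a ^+ 2 <= t * a * b by apply: le_trans abc _; apply: ler_wpM2r.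
have [->|a1] := eqVneq a 0; first exact: mulr_ge0.
have a2 : 0 < a by rewrite lt_neqAle eq_sym a1.
by rewrite -(ler_pM2l a2) -expr2 mulrCA mulrA.
Qed.

End Psd.

Lemma mxdot_CauchySchwarz m n (X Y : 'M[R]_(m, n)) :
  mxdot X Y ^+ 2 <= mxdot X X * mxdot Y Y.
Proof. by have := psdmx_CauchySchwarz (psdmx1 m) X Y; rewrite !mul1mx. Qed.


(** * Row means weighted by the eigenvector [psi] *)

Section WeightedMean.
Variables (n d : nat) (A : 'M[R]_n) (psi : 'cV[R]_n) (t : R).
Hypotheses (Apsi : A *m psi = t *: psi) (psi1 : mxdot psi psi = 1).
Implicit Types (u v : 'cV[R]_d) (Y : 'M[R]_(n, d)).

Lemma mxdot_outer u v : mxdot (psi *m u^T) (psi *m v^T) = mxdot u v.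
Proof.
rewrite mxdot_mull mulmxA.
have -> : psi^T *m psi = 1%:M.
  by rewrite [LHS]mx11_scalar; congr _%:M; move: psi1; rewrite /mxdot /mxtrace big_ord1.
by rewrite mul1mx mxdot_tr.
Qed.

Lemma mxdot_outerl u Y : mxdot (psi *m u^T) Y = mxdot u (Y^T *m psi).
Proof. by rewrite mxdot_mull -[RHS]mxdot_tr trmx_mul trmxK. Qed.

Lemma mxdot_mean_le Y : mxdot (Y^T *m psi) (Y^T *m psi) <= mxdot Y Y.
Proof.
rewrite -subr_ge0; set y := Y^T *m psi.
have := mxdot_ge0 (Y - psi *m y^T).
rewrite !mxdotBl !mxdotBr mxdot_outer (mxdotC Y (psi *m _)) mxdot_outerl -/y => H.
by lra.
Qed.

(** Positivity of [A] on [Y] minus its [psi]-component. That component has eigenvalue [t], hence the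
    gain of a factor [t] over [mxdot_mean_le]. *)
Lemma psd_mean_le Y : psdmx A -> mxdot Y (A *m Y) = mxdot Y Y ->
  t * mxdot (Y^T *m psi) (Y^T *m psi) <= mxdot Y Y.
Proof.
move=> psdA YAY; set y := Y^T *m psi.
have A_outer u : A *m (psi *m u^T) = t *: (psi *m u^T).
  by rewrite mulmxA Apsi scalemxAl.
have := psdmx_ge0 psdA (Y - psi *m y^T).
rewrite mulmxBr A_outer !mxdotBl !mxdotBr !mxdotZr mxdot_outer YAY.
rewrite (psdmx_sym psdA) A_outer mxdotZr (mxdotC Y (psi *m _)) mxdot_outerl -/y => H.
rewrite -subr_ge0; apply: le_trans H _.
by rewrite le_eqVlt; apply/orP; left; apply/eqP; ring.
Qed.

End WeightedMean.

(** * The cubic inequality from the matrices [W] and [X] *)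

Section MycielskiLower.
Variables (n d : nat) (A : 'M[R]_n) (psi : 'cV[R]_n) (t s : R).
Variables (W X : 'M[R]_(n, d)) (c q : 'cV[R]_d).
Hypotheses (psdA : psdmx A) (t1 : 1 <= t).
Hypothesis A_le : forall x : 'cV[R]_n, mxdot x (A *m x) <= t * mxdot x x.
Hypotheses (Apsi : A *m psi = t *: psi) (psi1 : mxdot psi psi = 1).
Hypotheses (WAW : mxdot W (A *m W) = mxdot W W) (XAW : mxdot X (A *m W) = mxdot X W).
Hypotheses (W_le : mxdot W W <= 1 + s) (X_le : mxdot X X <= 1 + s).
Hypotheses (Wc : W *m c = psi) (Xc : X *m c = psi) (Xq : X *m q = 0).
Hypotheses (c1 : mxdot c c = 1) (qc : mxdot q c = 1) (q_le : mxdot q q <= 1 + s).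

Let w := W^T *m psi.
Let x := X^T *m psi.

Let w_le : t * mxdot w w <= 1 + s.
Proof. exact: le_trans (psd_mean_le Apsi psi1 psdA WAW) W_le. Qed.

Let x_le : mxdot x x <= 1 + s.
Proof. exact: le_trans (mxdot_mean_le psi1 X) X_le. Qed.

(** Since [X] is orthogonal to [V = A W - W], removing the [psi]-components leaves the inner product
    [- (t - 1) <x, w>], to which Cauchy-Schwarz applies. *)
Let xw_le : (t - 1) * mxdot x w ^+ 2 <=
  (1 + s - mxdot x x) * (1 + s - (t - 1) * mxdot w w).
Proof.
have t1' := t1.
pose V := A *m W - W.
have XV : mxdot X V = 0 by rewrite mxdotBr XAW subrr.
have wV : V^T *m psi = (t - 1) *: w.
  by rewrite linearB /= mulmxBl trmx_mul psdA.1 -mulmxA Apsi -scalemxAr -/w scalerBl scale1r.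
(* [|V|^2 = |A W|^2 - |W|^2], and [|A W|^2 <= t |W|^2] by [psdmx_sqr_le]. *)
have VV : mxdot V V <= (t - 1) * (1 + s).
  rewrite mxdotBl !mxdotBr (mxdotC (A *m W) W) WAW.
  have := psdmx_sqr_le psdA W (le_trans ler01 t1) A_le; rewrite WAW => H.
  have : (t - 1) * mxdot W W <= (t - 1) * (1 + s) by apply: ler_wpM2l => //; lra.
  lra.
clearbody V.
have := mxdot_CauchySchwarz (X - psi *m x^T) (V - (t - 1) *: (psi *m w^T)).
rewrite !mxdotBl !mxdotBr !mxdotZl !mxdotZr !(mxdot_outer psi1) XV !mxdot_outerl wV -/x.
rewrite !(mxdotC _ (psi *m _)) !mxdot_outerl wV -/x !mxdotZr.
rewrite (mxdotC w x) => H.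
have XX := mxdot_ge0 (X - psi *m x^T).
move: XX; rewrite !mxdotBl !mxdotBr (mxdot_outer psi1) (mxdotC X (psi *m _)) mxdot_outerl -/x => XX.
have ww := mxdot_ge0 w.
have s0 : 0 <= 1 + s by apply: le_trans W_le; exact: mxdot_ge0.
(* Cauchy-Schwarz carries an extra factor [t - 1]; it can be cancelled only when nonzero. *)
have [tE|t_neq] := eqVneq t 1.
  rewrite tE subrr !mul0r subr0; apply: mulr_ge0 => //; have := x_le; lra.
have tp : 0 < t - 1 by rewrite subr_gt0 lt_neqAle eq_sym t_neq.
rewrite -(ler_pM2l tp).
set a := mxdot x w in H *; set X2 := mxdot X X in H XX *; set V2 := mxdot V V in H VV *.
set w2 := mxdot w w in H ww *; set x2 := mxdot x x in H XX *.
have {}H : (t - 1) ^+ 2 * a ^+ 2 <= (X2 - x2) * (V2 - (t - 1) ^+ 2 * w2).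
  apply: le_trans (le_trans H _); rewrite le_eqVlt; apply/orP; left; apply/eqP; ring.
have V0 : (X2 - x2) * (V2 - (t - 1) ^+ 2 * w2) <=
    (X2 - x2) * ((t - 1) * (1 + s - (t - 1) * w2)).
  apply: ler_wpM2l; first lra.
  rewrite [leRHS](_ : _ = (t - 1) * (1 + s) - (t - 1) ^+ 2 * w2); last ring.
  lra.
have V1 : (X2 - x2) * ((t - 1) * (1 + s - (t - 1) * w2)) <=
    (1 + s - x2) * ((t - 1) * (1 + s - (t - 1) * w2)).
  apply: ler_wpM2r; last by have := X_le; rewrite -/X2; lra.
  apply: mulr_ge0; first exact: ltW.
  have := w_le; rewrite -/w2; nra.
rewrite mulrA -expr2 (mulrCA (t - 1)).
exact: le_trans H (le_trans V0 V1).
Qed.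

Lemma mycielski_lower : [/\ 1 <= s, t - 1 <= s &
  (s + t) ^+ 2 * (t - s) <= 4 * t * (t - 1)].
Proof.
have qs := q_le.
have wc : mxdot w c = 1 by rewrite mxdot_mull trmxK Wc.
have xc : mxdot x c = 1 by rewrite mxdot_mull trmxK Xc.
have xq : mxdot x q = 0.
  by rewrite mxdot_mull trmxK Xq /mxdot mulmx0 mxtrace0.
have w1 : 1 <= mxdot w w.
  by have := mxdot_CauchySchwarz w c; rewrite wc c1 expr1n mulr1.
have x1 : 1 <= mxdot x x.
  by have := mxdot_CauchySchwarz x c; rewrite xc c1 expr1n mulr1.
have q1 : 1 <= mxdot q q.
  by have := mxdot_CauchySchwarz q c; rewrite qc c1 expr1n mulr1.
(* Cauchy-Schwarz for the parts of [x] and [w] orthogonal to [c]. *)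
have zwx : (mxdot x w - 1) ^+ 2 <= (mxdot w w - 1) * (mxdot x x - 1).
  have := mxdot_CauchySchwarz (x - c) (w - c).
  rewrite !mxdotBl !mxdotBr (mxdotC c w) (mxdotC c x) wc xc c1 => H.
  rewrite mulrC; apply: le_trans (le_trans H _); rewrite le_eqVlt; apply/orP; left; apply/eqP; ring.
(* [|q|^2 c - q] is the direction in the span of [c] and [q] orthogonal to [q], as [x] is.
   Cauchy-Schwarz with it gives [|x|^2 >= |q|^2 / (|q|^2 - 1)]. *)
have sx : 1 <= s * (mxdot x x - 1).
  have := mxdot_CauchySchwarz x (mxdot q q *: c - q).
  rewrite !mxdotBr !mxdotBl !mxdotZr !mxdotZl xc xq c1 qc (mxdotC c q) qc.
  set Q := mxdot q q in q1 qs *; set x2 := mxdot x x in x1 *.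
  rewrite mulr1 subr0 => H.
  have Q0 : 0 < Q by lra.
  have {}H : Q <= x2 * (Q - 1).
    rewrite -(ler_pM2l Q0); apply: le_trans (le_trans H _); last first.
      by rewrite le_eqVlt; apply/orP; left; apply/eqP; ring.
    by rewrite expr2.
  nra.
have t1' := t1; have xs := x_le; have ws := w_le.
have s0 : 0 < s by nra.
split; [nra|nra|].
exact: (@cubic_bound _ t s (mxdot w w) (mxdot x x) (mxdot x w)).
Qed.

End MycielskiLower.
End MxDot.

(** * Continuity, closed sets and attained maxima *)

Section Compactness.
Local Open Scope classical_set_scope.
Variable R : realType.

Lemma continuous_bigsum (T : topologicalType) (I : finType) (F : I -> T -> R) :
  (forall i, continuous (F i)) -> continuous (fun v => \sum_i F i v).
Proof.
move=> cF v; elim: (index_enum I) => [|i r IH].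
  under eq_fun do rewrite big_nil; exact: cvg_cst.
under eq_fun do rewrite big_cons.
by apply: cvgD => //; exact: cF.
Qed.

Lemma continuous_mulr (T : topologicalType) (f g : T -> R) :
  continuous f -> continuous g -> continuous (fun v => f v * g v).
Proof. by move=> cf cg v; apply: cvgM; [exact: cf|exact: cg]. Qed.

Lemma continuous_addr (T : topologicalType) (f g : T -> R) :
  continuous f -> continuous g -> continuous (fun v => f v + g v).
Proof. by move=> cf cg v; apply: cvgD; [exact: cf|exact: cg]. Qed.

Lemma continuous_oppr (T : topologicalType) (f : T -> R) :
  continuous f -> continuous (fun v => - f v).
Proof. by move=> cf v; apply: cvgN; exact: cf. Qed.

Lemma continuous_entry m n (i : 'I_m) (j : 'I_n) :
  continuous (fun v : 'rV[R]_(m * n) => vec_mx v i j).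
Proof. by under eq_fun do rewrite mxE; exact: coord_continuous. Qed.

Lemma closed_ge0 (T : topologicalType) (f : T -> R) :
  continuous f -> closed [set v | 0 <= f v].
Proof.
move=> cf; apply: (@closed_comp _ _ f [set x | 0 <= x]); last exact: closed_ge.
by move=> ? _; exact: cf.
Qed.

Lemma closed_eq0 (T : topologicalType) (f : T -> R) :
  continuous f -> closed [set v | f v = 0].
Proof.
move=> cf; apply: (@closed_comp _ _ f [set x | x = 0]); last exact: closed_eq.
by move=> ? _; exact: cf.
Qed.

Lemma closed_bounded_max n (K : set 'rV[R]_n) (f : 'rV[R]_n -> R) (M : R) :
  closed K -> K !=set0 -> (forall v, K v -> forall i, `|v 0 i| <= M) ->
  continuous f -> exists2 v, K v & forall v', K v' -> f v' <= f v.
Proof.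
move=> clK K0 KM cf.
have cK : compact K.
  apply: (@subclosed_compact _ _ [set v : 'rV[R]_n | forall i, `[- M, M] (v 0 i)]) => //.
    by apply: (@rV_compact _ _ (fun=> `[- M, M])) => i; exact: segment_compact.
  by move=> v /KM Mv i /=; rewrite in_itv /= -ler_norml.
have [v Kv maxv] := @compact_EVT_max _ R f K K0 cK (continuous_subspaceT cf).
exists v; first by rewrite inE in Kv.
by move=> v' Kv'; apply: maxv; rewrite inE.
Qed.

End Compactness.

(** * Semidefinite duality for the theta number *)

Section Duality.
Variable R : realType.

Section PsdEntries.
Variables (n : nat) (B : 'M[R]_n).
Hypothesis psdB : psdmx B.

Lemma mxdot_delta i j : mxdot (delta_mx i 0 : 'cV[R]_n) (B *m delta_mx j 0) = B i j.
Proof.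
rewrite -colE /mxdot trmx_delta -rowE /mxtrace big_ord1 !mxE //.
Qed.

Lemma psdmx_diag_ge0 i : 0 <= B i i.
Proof. by rewrite -mxdot_delta; apply: psdB.2. Qed.

Lemma psdmx_entry_le i j : B i j ^+ 2 <= B i i * B j j.
Proof.
have := psdmx_CauchySchwarz psdB (delta_mx i 0 : 'cV[R]_n) (delta_mx j 0).
by rewrite !mxdot_delta.
Qed.

Lemma psdmx_entry_eq0 i j : B i i = 0 -> B i j = 0.
Proof.
move=> Bi; apply/eqP; rewrite -sqrf_eq0 eq_le sqr_ge0 andbT.
by apply: le_trans (psdmx_entry_le i j) _; rewrite Bi mul0r.
Qed.

Lemma psdmx_diag_le_tr i : B i i <= \tr B.
Proof.
rewrite /mxtrace (bigD1 i) //= lerDl; apply: sumr_ge0 => j _; exact: psdmx_diag_ge0.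
Qed.

Lemma psdmx_tr_ge0 : 0 <= \tr B.
Proof. by apply: sumr_ge0 => i _; exact: psdmx_diag_ge0. Qed.

End PsdEntries.

Lemma psdmxZ n (B : 'M[R]_n) (k : R) : 0 <= k -> psdmx B -> psdmx (k *: B).
Proof.
move=> k0 [Bt B0]; split; first by rewrite linearZ /= Bt.
by move=> x; rewrite -scalemxAl mxdotZr mulr_ge0.
Qed.

Lemma psdmx_congr m n (B : 'M[R]_n) (P : 'M[R]_(n, m)) :
  psdmx B -> psdmx (P^T *m B *m P).
Proof.
move=> [Bt B0]; split; first by rewrite !trmx_mul trmxK Bt mulmxA.
by move=> x; rewrite -!mulmxA mxdotC mxdot_mull trmxK mxdotC; exact: B0.
Qed.

Variables (n : nat) (e : rel 'I_n).
Hypothesis e_sym : symmetric e.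

Definition edge_supported (B : 'M[R]_n) : Prop :=
  forall i j, i != j -> ~~ e i j -> B i j = 0.

Definition mxtotal (B : 'M[R]_n) : R := \sum_i \sum_j B i j.

Lemma mxtotalZ k B : mxtotal (k *: B) = k * mxtotal B.
Proof.
rewrite /mxtotal mulr_sumr; apply: eq_bigr => i _.
by rewrite mulr_sumr; apply: eq_bigr => j _; rewrite mxE.
Qed.

(** The feasible matrices of trace 1 form a closed set with entries in [-1, 1], so a maximiser
    exists; homogeneity passes to arbitrary trace, and trace 0 forces the zero matrix. *)
Lemma dual_max : (0 < n)%N -> exists B : 'M[R]_n,
  [/\ psdmx B, edge_supported B, \tr B = 1 &
      forall B', psdmx B' -> edge_supported B' -> mxtotal B' <= mxtotal B * \tr B'].
Proof.
move=> n0.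
pose feas (B : 'M[R]_n) := [/\ psdmx B, edge_supported B & \tr B = 1].
suff [B [psdB supB trB] Bmax] : exists2 B, feas B & forall B', feas B' -> mxtotal B' <= mxtotal B.
  exists B; split => // B' psdB' supB'.
  have [tr0|tr_neq] := eqVneq (\tr B') 0.
    rewrite tr0 mulr0 /mxtotal big1 // => i _; rewrite big1 // => j _.
    apply: psdmx_entry_eq0 => //; apply/eqP; rewrite eq_le psdmx_diag_ge0 // andbT.
    by rewrite -tr0 psdmx_diag_le_tr.
  have tr_gt0 : 0 < \tr B' by rewrite lt_neqAle eq_sym tr_neq psdmx_tr_ge0.
  have := Bmax ((\tr B')^-1 *: B'); rewrite mxtotalZ mulrC ler_pdivrMr //; apply.
  split; first by apply: psdmxZ => //; rewrite invr_ge0 ltW.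
    by move=> i j ij eij; rewrite mxE supB' // mulr0.
  by rewrite mxtraceZ mulVf.
have := @closed_bounded_max R (n * n) [set v | feas (vec_mx v)]%classic
  (fun v => mxtotal (vec_mx v)) 1.
case.
- have -> : [set v | feas (vec_mx v)]%classic =
    ((\bigcap_(x in [set: 'cV[R]_n]) [set v | 0 <= mxdot x (vec_mx v *m x)]) `&`
    ((\bigcap_(p in [set: 'I_n * 'I_n]) [set v | vec_mx v p.1 p.2 - vec_mx v p.2 p.1 = 0]) `&`
    ((\bigcap_(p in [set p : 'I_n * 'I_n | p.1 != p.2 /\ ~~ e p.1 p.2])
        [set v | vec_mx v p.1 p.2 = 0]) `&`
     [set v | \sum_i vec_mx v i i - 1 = 0])))%classic.
    apply/seteqP; split => v /=.
      move=> [[vt v0] vs vtr]; split; first by move=> x _; exact: v0.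
      split; first by move=> [i j] _ /=; apply/eqP; rewrite subr_eq0 -{1}vt mxE.
      split; first by move=> [i j] [/= ij eij]; exact: vs.
      by apply/eqP; rewrite subr_eq0; apply/eqP.
    move=> [v0 [vt [vs /eqP vtr]]]; split.
    - split; last by move=> x; exact: v0.
      apply/matrixP => i j; rewrite mxE; apply/eqP.
      by rewrite -subr_eq0; apply/eqP; exact: (vt (j, i)).
    - by move=> i j ij eij; exact: (vs (i, j)).
    - by apply/eqP; rewrite -subr_eq0.
  apply: closedI.
    apply: closed_bigI => x _; apply: closed_ge0.
    under eq_fun do rewrite mxdotE.
    apply: continuous_bigsum => i; apply: continuous_bigsum => j.
    apply: continuous_mulr; first exact: cst_continuous.
    under eq_fun do rewrite mxE; apply: continuous_bigsum => k.
    apply: continuous_mulr; last exact: cst_continuous.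
    exact: continuous_entry.
  apply: closedI.
    apply: closed_bigI => p _; apply: closed_eq0.
    by apply: continuous_addr; [|apply: continuous_oppr]; exact: continuous_entry.
  apply: closedI.
    by apply: closed_bigI => p _; apply: closed_eq0; exact: continuous_entry.
  apply: closed_eq0; apply: continuous_addr; last exact: cst_continuous.
  by apply: continuous_bigsum => i; exact: continuous_entry.
- pose i0 := Ordinal n0; exists (mxvec (delta_mx i0 i0)); rewrite /= mxvecK; split.
  + split; first by rewrite trmx_delta.
    move=> x; rewrite -(mul_delta_mx (0 : 'I_1)) -mulmxA mxdotC mxdot_mull trmx_delta.
    exact: mxdot_ge0.
  + move=> i j ij _; rewrite mxE; case: eqP => // ii; case: eqP => // jj.
    by rewrite ii jj eqxx in ij.
  + rewrite /mxtrace (bigD1 i0) //= mxE !eqxx /= big1 ?addr0 // => i ii0.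
    by rewrite mxE (negbTE ii0).
- move=> v /= [vpsd _ vtr] k.
  case: (mxvec_indexP k) => i j.
  have <- : vec_mx v i j = v 0 (mxvec_index i j) by rewrite mxE.
  (* An entry is controlled by the two diagonal entries, each at most the trace 1. *)
  rewrite -[leRHS]ger0_norm // -ler_sqr ?nnegrE ?normr_ge0 // !real_normK ?num_real //.
  apply: le_trans (psdmx_entry_le vpsd i j) _; rewrite expr1n -[leRHS]mulr1.
  apply: ler_pM; rewrite ?psdmx_diag_ge0 //; rewrite -vtr; exact: psdmx_diag_le_tr.
- apply: continuous_bigsum => i; apply: continuous_bigsum => j; exact: continuous_entry.
move=> v fv vmax; exists (vec_mx v) => // B' fB'.
by rewrite -(mxvecK B'); apply: vmax; rewrite /= mxvecK.
Qed.


(** First-order optimality condition for a one-sided perturbation: near 0 the linear term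
    dominates. *)
Lemma ge0_of_quadratic (a b : R) :
  (forall k, 0 <= k -> 0 <= 2 * k * a + k ^+ 2 * b) -> 0 <= a.
Proof.
move=> H; rewrite leNgt; apply/negP => a0.
have b1 : 0 < 1 + b ^+ 2 by have := sqr_ge0 b; lra.
have k0 : 0 <= - a / (1 + b ^+ 2) by apply: divr_ge0; lra.
have := H _ k0.
have -> : 2 * (- a / (1 + b ^+ 2)) * a + (- a / (1 + b ^+ 2)) ^+ 2 * b =
  - (a / (1 + b ^+ 2)) ^+ 2 * (2 * b ^+ 2 - b + 2).
  by field; rewrite gt_eqF.
rewrite mulNr oppr_ge0 leNgt => /negP; apply; apply: mulr_gt0; last by nra.
rewrite exprn_even_gt0 //=; apply: mulf_neq0; first by rewrite lt_eqF.
by rewrite invr_neq0 // gt_eqF.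
Qed.

(** The first-order condition from the other side. The range of [k] is cut at -1 because the
    perturbation will scale by the square root of [1 + k]. *)
Lemma le0_of_quadratic (a b : R) :
  (forall k, -1 <= k -> k <= 0 -> 0 <= 2 * k * a + k ^+ 2 * b) -> a <= 0.
Proof.
move=> H; rewrite leNgt; apply/negP => a0.
have b1 : 0 < 1 + a + `|b| by have := normr_ge0 b; lra.
set k := a / (1 + a + `|b|).
have k0 : 0 < k by exact: divr_gt0.
have k1 : k <= 1 by rewrite ler_pdivrMr // mul1r; have := normr_ge0 b; lra.
have kb : k * `|b| <= a.
  rewrite /k mulrAC ler_pdivrMr // ler_pM2l //; lra.
have kb' : k * b <= a by apply: le_trans kb; rewrite ler_pM2l // ler_norm.
have := H (- k); rewrite lerN2 oppr_le0 => /(_ k1 (ltW k0)).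
have -> : 2 * - k * a + (- k) ^+ 2 * b = k * (k * b - 2 * a) by ring.
rewrite pmulr_rge0 //; lra.
Qed.

Definition edge_mask (B : 'M[R]_n) : 'M[R]_n :=
  \matrix_(i, j) if (i == j) || e i j then B i j else 0.

Lemma edge_maskD B C : edge_mask (B + C) = edge_mask B + edge_mask C.
Proof. by apply/matrixP => i j; rewrite !mxE; case: ifP; rewrite ?addr0. Qed.

Lemma edge_maskZ k B : edge_mask (k *: B) = k *: edge_mask B.
Proof. by apply/matrixP => i j; rewrite !mxE; case: ifP; rewrite ?mulr0. Qed.

Lemma mxdot_edge_mask B C : mxdot (edge_mask B) (edge_mask C) = mxdot (edge_mask B) C.
Proof.
rewrite !mxdotE; apply: eq_bigr => i _; apply: eq_bigr => j _.
by rewrite !mxE; case: ifP; rewrite ?mul0r.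
Qed.

Lemma edge_mask_supported B : edge_supported (edge_mask B).
Proof. by move=> i j ij eij; rewrite mxE (negbTE ij) (negbTE eij). Qed.

Lemma mxdot_const1 B : mxdot B (const_mx 1) = mxtotal B.
Proof.
by rewrite mxdotE; apply: eq_bigr => i _; apply: eq_bigr => j _; rewrite mxE mulr1.
Qed.

(* The residual S of a best approximation U U^T of the target entries is itself
   dual feasible: U has a kernel vector h, as it has more columns than rows, and
   perturbing U along x h^T adds a multiple of x x^T to the Gram matrix. *)
Lemma primal_exact (l : R) :
  (forall B', psdmx B' -> edge_supported B' -> mxtotal B' <= l * \tr B') ->
  exists U : 'M[R]_(n, n.+1),
    forall i j, (i == j) || e i j -> (U *m U^T) i j = l * (i == j)%:R - 1.
Proof.
move=> Hl; pose P : 'M[R]_n := const_mx 1 - l%:M.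
pose res (Z : 'M[R]_n) := edge_mask (Z + P).
pose f (U : 'M[R]_(n, n.+1)) := mxdot (res (U *m U^T)) (res (U *m U^T)).
have [U Umin] : exists U, forall U', f U <= f U'.
  have fc : continuous (fun v : 'rV[R]_(n * n.+1) => f (vec_mx v)).
    rewrite /f; under eq_fun do rewrite mxdotE.
    have ec i j : continuous (fun v : 'rV[R]_(n * n.+1) => res (vec_mx v *m (vec_mx v)^T) i j).
      have -> : (fun v : 'rV[R]_(n * n.+1) => res (vec_mx v *m (vec_mx v)^T) i j) =
          (fun v => if (i == j) || e i j
                    then \sum_k vec_mx v i k * vec_mx v j k + P i j else 0).
        apply/funext => v; rewrite mxE; case: ifP => // _; rewrite mxE mxE.
        by congr (_ + _); apply: eq_bigr => k _; rewrite [X in _ * X]mxE.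
      case: ((i == j) || e i j); last exact: cst_continuous.
      apply: continuous_addr; last exact: cst_continuous.
      by apply: continuous_bigsum => k; apply: continuous_mulr; exact: continuous_entry.
    apply: continuous_bigsum => i; apply: continuous_bigsum => j.
    by apply: continuous_mulr; exact: ec.
  (* Minimising over the sublevel set of the zero matrix suffices. It is bounded: a diagonal
     residual has square at most [f 0], so squared row lengths are at most [f 0 + 1 + |l|], and the
     leading 1 absorbs the square root. *)
  have := @closed_bounded_max R (n * n.+1) [set v | 0 <= f 0 - f (vec_mx v)]%classic
    (fun v => - f (vec_mx v)) (1 + (f 0 + 1 + `|l|)).
  case.
  - apply: closed_ge0; apply: continuous_addr; first exact: cst_continuous.
    exact: continuous_oppr.
  - by exists 0; rewrite /= linear0 subrr.
  - move=> v /= fv k; case: (mxvec_indexP k) => i j.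
    have <- : vec_mx v i j = v 0 (mxvec_index i j) by rewrite mxE.
    move: (vec_mx v) fv => U; rewrite subr_ge0 => fU.
    have f00 : 0 <= f 0 by exact: mxdot_ge0.
    pose z := (U *m U^T) i i + 1 - l.
    have zE : res (U *m U^T) i i = z.
      rewrite mxE eqxx mxE /z -addrA; congr (_ + _).
      by rewrite !mxE eqxx mulr1n.
    have zf : z ^+ 2 <= f 0.
      apply: le_trans fU; rewrite /f mxdotE (bigD1 i) //= (bigD1 i) //= zE -expr2 -addrA lerDl.
      apply: addr_ge0; apply: sumr_ge0 => ? _; first by rewrite -expr2 sqr_ge0.
      by apply: sumr_ge0 => ? _; rewrite -expr2 sqr_ge0.
    have zle : z <= f 0 + 1 by nra.
    have Uij : U i j ^+ 2 <= (U *m U^T) i i.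
      rewrite mxE (bigD1 j) //= mxE -expr2 lerDl; apply: sumr_ge0 => ? _.
      by rewrite mxE -expr2 sqr_ge0.
    have ll := ler_norm l.
    have : U i j ^+ 2 <= f 0 + 1 + `|l| by move: zle; rewrite /z; lra.
    have l0 := normr_ge0 l.
    rewrite -(@real_normK _ (U i j)) ?num_real //.
    have := normr_ge0 (U i j); nra.
  - exact: continuous_oppr.
  move=> v /= fv vmin; exists (vec_mx v) => U'.
  have [fU'|fU'] := leP (f U') (f 0); last first.
    by apply: le_trans (ltW fU'); rewrite -subr_ge0.
  by have := vmin (mxvec U'); rewrite /= mxvecK subr_ge0 lerN2; apply.
pose S := res (U *m U^T).
have resD k Z : res (U *m U^T + k *: Z) = S + k *: edge_mask Z.
  by rewrite /res addrAC edge_maskD edge_maskZ.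
have expand k Z : mxdot (S + k *: edge_mask Z) (S + k *: edge_mask Z) =
    mxdot S S + (2 * k * mxdot S Z + k ^+ 2 * mxdot (edge_mask Z) (edge_mask Z)).
  rewrite mxdotDl !mxdotDr !mxdotZl !mxdotZr (mxdotC (edge_mask Z) S).
  have -> : mxdot S (edge_mask Z) = mxdot S Z by exact: mxdot_edge_mask.
  ring.
have S_tr : S^T = S.
  have Gt : (U *m U^T)^T = U *m U^T by rewrite trmx_mul trmxK.
  apply/matrixP => i j; rewrite mxE [LHS]mxE [RHS]mxE eq_sym e_sym; case: ifP => // _.
  rewrite [LHS]mxE [RHS]mxE; congr (_ + _); first by rewrite -{1}Gt mxE.
  by rewrite !mxE eq_sym.
have [h hh Uh] : exists2 h : 'cV[R]_n.+1, mxdot h h = 1 & U *m h = 0.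
  have : kermx U^T != 0.
    rewrite kermx_eq0 /row_free; apply/negP => /eqP rk.
    by have := rank_leq_col U^T; rewrite rk ltnn.
  case/rowV0Pn => r /sub_kermxP rU r0.
  have r1 : 0 < mxdot r r.
    by rewrite lt_neqAle mxdot_ge0 andbT eq_sym; apply: contraNN r0 => /eqP /mxdot_eq0 ->.
  exists ((Num.sqrt (mxdot r r))^-1 *: r^T).
    rewrite mxdotZl mxdotZr mxdot_tr mulrA -expr2 exprVn sqr_sqrtr ?(ltW r1) //.
    by rewrite mulVf // gt_eqF.
  rewrite -scalemxAr; apply/eqP; rewrite scaler_eq0; apply/orP; right.
  by rewrite -[U]trmxK -trmx_mul rU trmx0.
(* The cross terms of the perturbation vanish by [Uh], so the residual moves by [k] times the masked
   [x x^T], for any [k >= 0]. *)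
have psdS : psdmx S.
  split=> // x; apply: (@ge0_of_quadratic _ (mxdot (edge_mask (x *m x^T)) (edge_mask (x *m x^T)))).
  move=> k k0.
  have := Umin (U + Num.sqrt k *: (x *m h^T)).
  have hh' : h^T *m h = 1%:M.
    by rewrite [LHS]mx11_scalar; congr _%:M; move: hh; rewrite /mxdot /mxtrace big_ord1.
  rewrite /f.
  have -> : (U + Num.sqrt k *: (x *m h^T)) *m (U + Num.sqrt k *: (x *m h^T))^T =
      U *m U^T + k *: (x *m x^T).
    rewrite linearD linearZ /= trmx_mul trmxK mulmxDl !mulmxDr -!scalemxAr -!scalemxAl.
    have -> : U *m (h *m x^T) = 0 by rewrite mulmxA Uh mul0mx.
    have -> : x *m h^T *m U^T = 0 by rewrite -mulmxA -trmx_mul Uh trmx0 mulmx0.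
    have -> : x *m h^T *m (h *m x^T) = x *m x^T.
      by rewrite mulmxA -(mulmxA x) hh' mulmx1.
    by rewrite !scaler0 addr0 add0r scalerA -expr2 sqr_sqrtr.
  rewrite resD expand -/S lerDl.
  suff -> : mxdot S (x *m x^T) = mxdot x (S *m x) by [].
  by rewrite mxdotC mxdot_mull mxdotC -[LHS]mxdot_tr trmxK trmx_mul trmxK S_tr mxdotC.
(* Optimality under shrinking [U]. *)
have SZ : mxdot S (U *m U^T) <= 0.
  apply: (@le0_of_quadratic _ (mxdot (edge_mask (U *m U^T)) (edge_mask (U *m U^T)))) => k k1 k0.
  have := Umin (Num.sqrt (1 + k) *: U); rewrite /f.
  have -> : (Num.sqrt (1 + k) *: U) *m (Num.sqrt (1 + k) *: U)^T = U *m U^T + k *: (U *m U^T).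
    rewrite linearZ /= -scalemxAr -scalemxAl scalerA -expr2 sqr_sqrtr; last by lra.
    by rewrite scalerDl scale1r.
  by rewrite resD expand -/S lerDl.
(* [|S|^2 = <S, U U^T> + mxtotal S - l tr S], where the first term is at most 0 by [SZ] and the rest
   by dual feasibility of [S]. *)
have S0 : S = 0.
  apply: mxdot_eq0; apply/eqP; rewrite eq_le mxdot_ge0 andbT.
  rewrite {2}/S /res mxdot_edge_mask -/(res _) -/S mxdotDr mxdotBr mxdot_const1.
  have -> : mxdot S l%:M = l * \tr S.
    by rewrite -scalemx1 mxdotZr /mxdot mulmx1 mxtrace_tr.
  have := Hl S psdS (@edge_mask_supported _); lra.
exists U => i j eij.
have SE : S i j = (U *m U^T) i j + P i j by rewrite mxE eij mxE.
have PE : P i j = 1 - l * (i == j)%:R by rewrite !mxE mulr_natr.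
by move: SE; rewrite S0 mxE PE; lra.
Qed.

Theorem theta_duality : (0 < n)%N -> exists l : R, [/\ 1 <= l,
  exists U : 'M[R]_(n, n.+1),
    forall i j, (i == j) || e i j -> (U *m U^T) i j = l * (i == j)%:R - 1 &
  exists (A : 'M[R]_n) (psi : 'cV[R]_n),
    [/\ psdmx A /\ (forall x : 'cV[R]_n, mxdot x (A *m x) <= l * mxdot x x),
        A *m psi = l *: psi, mxdot psi psi = 1, edge_supported A &
        forall i, psi i 0 != 0 -> A i i = 1]].
Proof.
move=> n0; have [B [psdB supB trB Bmax]] := dual_max n0.
set l := mxtotal B in Bmax.
have diag_supp (x : 'rV[R]_n) (C : 'M[R]_n) : edge_supported C ->
    edge_supported ((diag_mx x)^T *m C *m diag_mx x).
  move=> supC i j ij eij; rewrite tr_diag_mx mul_mx_diag mxE mul_diag_mx mxE.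
  by rewrite supC // mulr0 mul0r.
(* The identity matrix is feasible up to scale, with total equal to trace. *)
have l1 : 1 <= l.
  have := Bmax 1%:M (psdmx1 R n).
  have -> : mxtotal (1%:M : 'M[R]_n) = n%:R.
    rewrite /mxtotal -[RHS]mul1r -[n in RHS]card_ord mulr_natr -sumr_const.
    apply: eq_bigr => i _; rewrite (bigD1 i) //= mxE eqxx big1 ?addr0 // => j ji.
    by rewrite mxE eq_sym (negbTE ji).
  rewrite mxtrace1 ler_pMl ?ltr0n //; apply => i j ij _.
  by rewrite mxE (negbTE ij).
exists l; split => //; first exact: primal_exact.
pose psi : 'cV[R]_n := \col_i Num.sqrt (B i i).
(* Where [B i i = 0] the convention [0^-1 = 0] applies; there the whole row and column of [B]
   vanish. *)
pose r : 'rV[R]_n := \row_i (Num.sqrt (B i i))^-1.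
pose A := (diag_mx r)^T *m B *m diag_mx r.
have AE i j : A i j = (Num.sqrt (B i i))^-1 * B i j * (Num.sqrt (B j j))^-1.
  by rewrite /A tr_diag_mx mul_mx_diag mxE mul_diag_mx mxE !mxE.
have psdA : psdmx A by exact: psdmx_congr.
have supA : edge_supported A by exact: diag_supp.
have sqrtB_neq0 i : B i i != 0 -> Num.sqrt (B i i) != 0.
  by move=> Bi; rewrite -sqrf_eq0 sqr_sqrtr // psdmx_diag_ge0.
have A1 i : B i i != 0 -> A i i = 1.
  move=> Bi; rewrite AE -{2}(sqr_sqrtr (psdmx_diag_ge0 psdB i)).
  by field; exact: sqrtB_neq0.
have A_le1 i : A i i <= 1.
  have [Bi|/A1 -> //] := eqVneq (B i i) 0.
  by rewrite AE Bi mulr0 mul0r.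
(* Optimality of [B] is tested on [diag(x) A diag(x)]: its total is [<x, A x>], and its trace is at
   most [|x|^2] since the diagonal of [A] is at most 1. *)
have Ale (x : 'cV[R]_n) : mxdot x (A *m x) <= l * mxdot x x.
  have := Bmax _ (psdmx_congr (diag_mx x^T) psdA) (diag_supp x^T _ supA).
  have E i j : ((diag_mx x^T)^T *m A *m diag_mx x^T) i j = x i 0 * A i j * x j 0.
    by rewrite tr_diag_mx mul_mx_diag mxE mul_diag_mx mxE !mxE.
  have -> : mxtotal ((diag_mx x^T)^T *m A *m diag_mx x^T) = mxdot x (A *m x).
    rewrite mxdotE; apply: eq_bigr => i _; rewrite big_ord1 mxE mulr_sumr.
    by apply: eq_bigr => j _; rewrite E mulrA.
  move=> H; apply: le_trans H _; apply: ler_wpM2l; first by lra.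
  rewrite mxdotE; apply: ler_sum => i _; rewrite big_ord1 E mulrAC -expr2.
  by rewrite ler_piMr // sqr_ge0.
have psiE i : psi i 0 ^+ 2 = B i i by rewrite mxE sqr_sqrtr // psdmx_diag_ge0.
have psi1 : mxdot psi psi = 1.
  by rewrite mxdotE -trB; apply: eq_bigr => i _; rewrite big_ord1 -expr2 psiE.
have psi_l : mxdot psi (A *m psi) = l.
  rewrite mxdotE; apply: eq_bigr => i _; rewrite big_ord1 [X in _ * X]mxE mulr_sumr.
  apply: eq_bigr => j _; rewrite AE.
  have [Bi|Bi] := eqVneq (B i i) 0; first by rewrite (psdmx_entry_eq0 psdB j Bi) !(mulr0, mul0r).
  have [Bj|Bj] := eqVneq (B j j) 0.
    have -> : B i j = B j i by rewrite -{1}psdB.1 mxE.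
    by rewrite (psdmx_entry_eq0 psdB i Bj) !(mulr0, mul0r).
  rewrite !mxE; field.
  by rewrite !sqrtB_neq0.
exists A, psi; split => //; last by move=> i; rewrite -sqrf_eq0 psiE; exact: A1.
(* [psi] attains the bound [Ale], so it lies in the kernel of this form. *)
have psdC : psdmx (l%:M - A).
  split; first by rewrite linearB /= tr_scalar_mx psdA.1.
  by move=> x; rewrite mulmxBl mul_scalar_mx mxdotBr mxdotZr subr_ge0.
have /(psdmx_ker psdC) : mxdot psi ((l%:M - A) *m psi) = 0.
  by rewrite mulmxBl mul_scalar_mx mxdotBr mxdotZr psi1 psi_l mulr1 subrr.
by rewrite mulmxBl mul_scalar_mx => /eqP; rewrite subr_eq0 => /eqP.
Qed.

End Duality.

(** * Graph representations and the two bounds for theta *)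

Section GraphReps.
Variable R : realType.

Lemma dotvE d (u v : 'rV[R]_d) : dotv u v = mxdot u v.
Proof. by rewrite mxdotE big_ord1. Qed.

(* Dual orthonormal representations rescaled so that <c, w_v> = 1; the value
   1 / <c, u_v>^2 becomes |w_v|^2. *)
Definition scaled_rep (H : sgraph) (d : nat) (c : 'rV[R]_d) (w : H -> 'rV[R]_d)
    (tau : R) : Prop :=
  [/\ mxdot c c = 1, forall v, mxdot c (w v) = 1,
      forall u v, adj u v -> mxdot (w u) (w v) = 0 &
      forall v, mxdot (w v) (w v) <= tau].

Lemma theta_bar_values_scaled_rep (H : sgraph) d (c : 'rV[R]_d) w tau :
  (0 < #|H|)%N -> @scaled_rep H d c w tau ->
  exists2 t : R, theta_bar_values H t & t <= tau.
Proof.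
move=> /card_gt0P[v0 _] [c1 cw ww wtau].
have w_gt0 v : 0 < mxdot (w v) (w v).
  rewrite lt_neqAle mxdot_ge0 andbT eq_sym; apply/eqP => /mxdot_eq0 w0.
  by have := cw v; rewrite w0 /mxdot mulmx0 mxtrace0 => /eqP; rewrite eq_sym oner_eq0.
pose r v := Num.sqrt (mxdot (w v) (w v)).
have r_neq0 v : r v != 0 by rewrite gt_eqF // sqrtr_gt0.
have rE v : r v ^+ 2 = mxdot (w v) (w v) by rewrite sqr_sqrtr ?mxdot_ge0.
exists (\big[Num.max/0]_(v : H) (1 / dotv c ((r v)^-1 *: w v) ^+ 2)).
  exists d, (fun v => (r v)^-1 *: w v), c; split => //.
  - split=> [v|u v _ uv]; rewrite dotvE mxdotZl mxdotZr.
      by rewrite -rE; field.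
    by rewrite ww // !mulr0.
  - by rewrite dotvE.
  - by move=> v; rewrite dotvE mxdotZr cw mulr1 invr_neq0.
(* The base value 0 of the maximum must also lie below [tau]; a vertex witnesses this. *)
apply/bigmax_leP; split=> [|v _].
  exact: le_trans (mxdot_ge0 _) (wtau v0).
by rewrite dotvE mxdotZr cw mulr1 exprVn div1r invrK rE.
Qed.

Lemma theta_bar_le (H : sgraph) d (c : 'rV[R]_d) w tau :
  (0 < #|H|)%N -> @scaled_rep H d c w tau -> theta_bar R H <= tau.
Proof.
move=> H0 /(theta_bar_values_scaled_rep H0)[t Ht]; apply: le_trans.
apply: ge_inf => //; exists 0 => _ [d' [u [c' [_ _ _ ->]]]].
exact: bigmax_ge_id.
Qed.

(** The first hypothesis keeps [inf] away from its default value on the empty set; dividing each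
    [u v] by its inner product with [c] gives a scaled representation. *)
Lemma theta_bar_ge (H : sgraph) (l : R) :
  (exists t : R, theta_bar_values H t) ->
  (forall d (c : 'rV[R]_d) w tau, @scaled_rep H d c w tau -> l <= tau) ->
  l <= theta_bar R H.
Proof.
move=> H0 Hl; apply: lb_le_inf => // t [d [u [c [[u1 uu] c1 cu ->]]]].
apply: (Hl d c (fun v => (dotv c (u v))^-1 *: u v)); split.
- by rewrite -dotvE.
- by move=> v; rewrite mxdotZr -dotvE mulVf.
- move=> x y xy; rewrite mxdotZl mxdotZr -dotvE uu ?mulr0 //.
  by apply: contraTneq xy => ->; rewrite adj_irrefl.
- move=> v; rewrite mxdotZl mxdotZr -!dotvE u1 mulr1 -expr2 exprVn -div1r.
  exact: (le_bigmax _ (fun v => 1 / dotv c (u v) ^+ 2)).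
Qed.

Section Weighted.
Variables (n d : nat) (e : rel 'I_n) (A : 'M[R]_n) (psi : 'cV[R]_n).
Hypotheses (psi1 : mxdot psi psi = 1) (supA : edge_supported e A).
Hypothesis A1 : forall i, psi i 0 != 0 -> A i i = 1.

Definition weighted (W : 'M[R]_(n, d)) := diag_mx psi^T *m W.

Lemma weighted_gram W X i j :
  (weighted X *m (weighted W)^T) i j = psi i 0 * psi j 0 * (X *m W^T) i j.
Proof.
rewrite /weighted trmx_mul tr_diag_mx !mulmxA -(mulmxA _ X) mul_mx_diag mxE mul_diag_mx mxE.
by rewrite !mxE mulrAC.
Qed.

(** Off the diagonal either [A] or the Gram entry vanishes, and on the diagonal [A] is 1 wherever
    the weight is nonzero; only the trace of the weighted Gram matrix is left. *)
Lemma mxdot_weighted W X : (forall i j, e i j -> (X *m W^T) i j = 0) ->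
  mxdot (weighted X) (A *m weighted W) = mxdot (weighted X) (weighted W).
Proof.
move=> XW; rewrite [RHS]/mxdot [RHS]mxtrace_mulC -[RHS]mxtrace_tr trmx_mul trmxK.
rewrite mxdotC mxdot_mulr mxdotE; apply: eq_bigr => i _.
rewrite (bigD1 i) //= big1 ?addr0 => [|j ji].
  rewrite weighted_gram; have [->|p0] := eqVneq (psi i 0) 0; first by rewrite !mul0r mulr0.
  by rewrite A1 // mul1r.
rewrite weighted_gram; case: (boolP (e i j)) => eij; first by rewrite XW // !mulr0.
by rewrite supA ?mul0r // eq_sym.
Qed.

Lemma weighted_le W tau : (forall i, (W *m W^T) i i <= tau) ->
  mxdot (weighted W) (weighted W) <= tau.
Proof.
move=> Wtau; rewrite /mxdot mxtrace_mulC -[tau]mulr1 -psi1 mxdotE mulr_sumr.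
apply: ler_sum => i _; rewrite weighted_gram big_ord1 mulrC.
by apply: ler_wpM2r => //; rewrite -expr2 sqr_ge0.
Qed.

Lemma weighted_mul W (c : 'cV[R]_d) k : W *m c = const_mx k -> weighted W *m c = k *: psi.
Proof.
move=> Wc; rewrite /weighted -mulmxA Wc mul_diag_mx; apply/matrixP => i j.
by rewrite !mxE (ord1 j) mulrC.
Qed.

End Weighted.

Lemma mul_rows_tr n d (f g : 'I_n -> 'rV[R]_d) i j :
  ((\matrix_i f i) *m (\matrix_i g i)^T) i j = mxdot (f i) (g j).
Proof. by rewrite mxdotE big_ord1 mxE; apply: eq_bigr => k _; rewrite !mxE. Qed.

Lemma rows_mul_col n d (f : 'I_n -> 'rV[R]_d) (c : 'rV[R]_d) k :
  (forall i, mxdot c (f i) = k) -> (\matrix_i f i) *m c^T = const_mx k.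
Proof.
move=> fk; apply/matrixP => i j; rewrite [RHS]mxE -(fk i) mxdotC mxdotE big_ord1 mxE.
by apply: eq_bigr => l _; rewrite !mxE (ord1 j).
Qed.

(** Coordinates along the orthonormal [c] and [e] of the construction, then in the space of the
    [y_v]. *)
Definition vec2 d (a b : R) (y : 'rV[R]_d) : 'rV[R]_(1 + (1 + d)) :=
  row_mx a%:M (row_mx b%:M y).

Lemma mxdot_vec2 d a b (y : 'rV[R]_d) a' b' y' :
  mxdot (vec2 a b y) (vec2 a' b' y') = a * a' + (b * b' + mxdot y y').
Proof.
have mxdot_row d1 d2 (x x' : 'rV[R]_d1) (z z' : 'rV[R]_d2) :
    mxdot (row_mx x z) (row_mx x' z') = mxdot x x' + mxdot z z'.
  rewrite !mxdotE !big_ord1 big_split_ord /=; congr (_ + _).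
    by apply: eq_bigr => i _; rewrite !row_mxEl.
  by apply: eq_bigr => i _; rewrite !row_mxEr.
have mxdot11 k k' : mxdot (k%:M : 'M[R]_1) k'%:M = k * k'.
  by rewrite mxdotE !big_ord1 !mxE !eqxx !mulr1n.
by rewrite /vec2 !mxdot_row !mxdot11.
Qed.

Section FixG.
Variables (G : sgraph) (l : R).
Hypothesis l1 : 1 <= l.

Section Lower.
Let n := #|G|.
Let e : rel 'I_n := fun i j => adj (enum_val i) (enum_val j).
Variables (A : 'M[R]_n) (psi : 'cV[R]_n).
Hypotheses (psdA : psdmx A) (Ale : forall x : 'cV[R]_n, mxdot x (A *m x) <= l * mxdot x x).
Hypotheses (Apsi : A *m psi = l *: psi) (psi1 : mxdot psi psi = 1).
Hypotheses (supA : edge_supported e A) (A1 : forall i, psi i 0 != 0 -> A i i = 1).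

(** The mean [W^T psi] has inner product 1 with [c], so its length is at least 1, and [psd_mean_le]
    gives [l <= |W|^2 <= tau]. *)
Lemma scaled_rep_ge d (c : 'rV[R]_d) w tau : @scaled_rep G d c w tau -> l <= tau.
Proof.
move=> [c1 cw ww wtau]; pose W := weighted psi (\matrix_i w (enum_val i)).
have WAW : mxdot W (A *m W) = mxdot W W.
  by apply: (mxdot_weighted supA A1) => i j eij; rewrite mul_rows_tr ww.
have Wtau : mxdot W W <= tau.
  by apply: (weighted_le psi1) => i; rewrite mul_rows_tr.
have Wc : W *m c^T = psi.
  by rewrite -[RHS]scale1r; apply: weighted_mul; apply: rows_mul_col.
have := psd_mean_le Apsi psi1 psdA WAW.
have := mxdot_CauchySchwarz (W^T *m psi) c^T.
rewrite mxdot_mull trmxK Wc psi1 mxdot_tr c1 mulr1 expr1n => m1 lm.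
apply: le_trans Wtau; apply: le_trans lm; rewrite ler_peMr //.
by apply: le_trans l1.
Qed.

Lemma mycielskian_rep_ge d (c : 'rV[R]_d) w tau :
  @scaled_rep (mycielskian G) d c w tau -> 1 + mycielski_root l <= tau.
Proof.
move=> [c1 cw ww wtau].
pose W := weighted psi (\matrix_i w (Some (enum_val i, false))).
pose X := weighted psi (\matrix_i w (Some (enum_val i, true))).
have tauE : 1 + (tau - 1) = tau by ring.
have WAW : mxdot W (A *m W) = mxdot W W.
  by apply: (mxdot_weighted supA A1) => i j eij; rewrite mul_rows_tr ww //= andbT.
have XAW : mxdot X (A *m W) = mxdot X W.
  by apply: (mxdot_weighted supA A1) => i j eij; rewrite mul_rows_tr ww //= andbT.
have Wtau : mxdot W W <= 1 + (tau - 1).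
  by rewrite tauE; apply: (weighted_le psi1) => i; rewrite mul_rows_tr.
have Xtau : mxdot X X <= 1 + (tau - 1).
  by rewrite tauE; apply: (weighted_le psi1) => i; rewrite mul_rows_tr.
have Wc : W *m c^T = psi.
  by rewrite -[RHS]scale1r; apply: weighted_mul; apply: rows_mul_col.
have Xc : X *m c^T = psi.
  by rewrite -[RHS]scale1r; apply: weighted_mul; apply: rows_mul_col.
have Xq : X *m (w None)^T = 0.
  rewrite -[RHS](scale0r psi); apply: weighted_mul; apply: rows_mul_col => i.
  exact: ww.
have [|||s1 ls cubic] := mycielski_lower psdA l1 Ale Apsi psi1 WAW XAW Wtau Xtau Wc Xc Xq.
- by rewrite mxdot_tr.
- by rewrite mxdot_tr mxdotC.
- by rewrite mxdot_tr tauE.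
have [r1 r2 rE] := mycielski_rootP l1.
have l1' := l1.
(* Either 1 or [l - 1] is at least [l / 3], and [tau - 1] exceeds both. *)
have l3 : l / 3 <= tau - 1 by lra.
by rewrite -lerBrDl; exact: cubic_root_le l1 l3 rE cubic.
Qed.

End Lower.

Section Upper.
Variable d : nat.
Variable y : G -> 'rV[R]_d.
Hypotheses (yy : forall v, mxdot (y v) (y v) = l - 1).
Hypothesis (yadj : forall u v, adj u v -> mxdot (y u) (y v) = -1).

Lemma graph_scaled_rep :
  @scaled_rep G _ (vec2 1 0 0) (fun v => vec2 1 0 (y v)) l.
Proof.
split=> [|v|u v uv|v]; rewrite mxdot_vec2 ?yy ?yadj //.
- by rewrite /mxdot mulmx0 mxtrace0; ring.
- by rewrite /mxdot linear0 mul0mx mxtrace0; ring.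
- by ring.
- by rewrite le_eqVlt; apply/orP; left; apply/eqP; ring.
Qed.

Lemma mycielskian_scaled_rep : exists w : mycielskian G -> 'rV[R]_(1 + (1 + d)),
  scaled_rep (vec2 1 0 0) w (1 + mycielski_root l).
Proof.
have [r1 r2 rE] := mycielski_rootP l1; set s := mycielski_root l in r1 r2 rE *.
have l1' := l1.
have s0 : 0 < s by lra.
have l0 : 0 < l by lra.
have ls := cubic_root_ge l1 r1 rE.
(* [a] makes z orthogonal to (v, 1), [g] handles edges among the (v, 0), and [k] those between (v,
   0) and (w, 1). [b] then gives (v, 0) squared length [g^2 l = 1 + s]; its radicand is nonnegative
   by [ls]. *)
pose a := (Num.sqrt s)^-1.
pose b := Num.sqrt ((1 + s - l) / l).
pose g := Num.sqrt (1 + b ^+ 2).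
pose k := (1 - b * a) / g.
have a0 : 0 <= a by rewrite invr_ge0 sqrtr_ge0.
have b0 : 0 <= b by exact: sqrtr_ge0.
have aE : a ^+ 2 * s = 1.
  by rewrite exprVn sqr_sqrtr ?(ltW s0) // mulVf // gt_eqF.
have bE : b ^+ 2 * l = 1 + s - l.
  by rewrite sqr_sqrtr ?divfK ?gt_eqF // divr_ge0 ?(ltW l0) //; lra.
have gE : g ^+ 2 = 1 + b ^+ 2 by rewrite sqr_sqrtr // addr_ge0 ?sqr_ge0.
have g0 : g != 0 by rewrite -sqrf_eq0 gE gt_eqF // ltr_wpDr ?sqr_ge0.
have gl : g ^+ 2 * l = 1 + s by rewrite gE mulrDl bE; ring.
have kg : k * g = 1 - b * a by rewrite /k divfK.
(* The one remaining condition, the squared length of (v, 1), is where the cubic enters. *)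
have kl : k ^+ 2 * (l - 1) = s - a ^+ 2.
  have baE : (b * a) ^+ 2 * (l * s) = 1 + s - l by rewrite exprMn mulrACA bE aE mulr1.
  have := cubic_root_weight l1 ls r2 s0 (mulr_ge0 b0 a0) baE rE.
  rewrite -kg => E.
  have s1 : 1 + s != 0 by rewrite gt_eqF //; lra.
  apply: (mulIf (lt0r_neq0 s0)); apply: (mulIf s1).
  rewrite mulrBl aE -expr2 -E -gl; ring.
exists (fun x => match x with
  | None => vec2 1 (- Num.sqrt s) 0
  | Some (v, false) => vec2 1 (- b) (g *: y v)
  | Some (v, true) => vec2 1 a (k *: y v)
  end).
have mxdot0l (z : 'rV[R]_d) : mxdot 0 z = 0 by rewrite /mxdot linear0 mul0mx mxtrace0.
have mxdot0r (z : 'rV[R]_d) : mxdot z 0 = 0 by rewrite mxdotC.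
have sa : Num.sqrt s * a = 1 by rewrite divff // gt_eqF // sqrtr_gt0.
split.
- by rewrite mxdot_vec2 mxdot0l; ring.
- by case=> [[v []]|]; rewrite mxdot_vec2 mxdot0l; ring.
- case=> [[u i]|] [[v j]|] //=.
  + case/andP => uv; case: i; case: j => //= _; rewrite mxdot_vec2 mxdotZl mxdotZr yadj //.
    * by transitivity (1 - b * a - k * g); [ring|rewrite kg subrr].
    * by transitivity (1 - b * a - k * g); [ring|rewrite kg subrr].
    * by transitivity (1 + b ^+ 2 - g ^+ 2); [ring|rewrite gE subrr].
  + case: i => // _; rewrite mxdot_vec2 mxdot0r.
    by transitivity (1 - Num.sqrt s * a); [ring|rewrite sa subrr].
  + case: j => // _; rewrite mxdot_vec2 mxdot0l.
    by transitivity (1 - Num.sqrt s * a); [ring|rewrite sa subrr].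
- case=> [[v []]|]; rewrite mxdot_vec2 ?mxdotZl ?mxdotZr ?yy ?mxdot0l le_eqVlt;
    apply/orP; left; apply/eqP.
  + by transitivity (1 + (a ^+ 2 + k ^+ 2 * (l - 1))); [ring|rewrite kl; ring].
  + by transitivity (1 + b ^+ 2 - g ^+ 2 + g ^+ 2 * l); [ring|rewrite gE subrr add0r -gE].
  + by rewrite mul1r mulrNN -expr2 sqr_sqrtr ?(ltW s0) // addr0.
Qed.

End Upper.
End FixG.
End GraphReps.

(** * Combination of the bounds for G and for its Mycielskian *)

Theorem theorem2 (R : realType) (G : sgraph) (hG : (0 < #|G|)%N) :
  theta_bar R (mycielskian G) =
    4 / 3 * theta_bar R G *
      cos (1 / 3 * acos (1 - 27 / (4 * theta_bar R G)
                           + 27 / (4 * theta_bar R G ^+ 2)))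
    - 1 / 3 * theta_bar R G + 1.
Proof.
pose e : rel 'I_#|G| := fun i j => adj (enum_val i) (enum_val j).
have e_sym : symmetric e by move=> i j; exact: adj_sym.
have [l [l1 [U UE] [A [psi [[psdA Ale] Apsi psi1 supA A1]]]]] := theta_duality R e_sym hG.
pose y (v : G) := row (enum_rank v) U.
have yE u v : mxdot (y u) (y v) = (U *m U^T) (enum_rank u) (enum_rank v).
  by rewrite mxdotE big_ord1 mxE; apply: eq_bigr => k _; rewrite !mxE.
have yy v : mxdot (y v) (y v) = l - 1 by rewrite yE UE eqxx ?mulr1.
have yadj u v : adj u v -> mxdot (y u) (y v) = -1.
  move=> uv; have uNv : u != v by apply: contraTneq uv => ->; rewrite adj_irrefl.
  rewrite yE UE; last by rewrite /e !enum_rankK uv orbT.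
  by rewrite (inj_eq enum_rank_inj) (negbTE uNv) mulr0 sub0r.
have repG := graph_scaled_rep yy yadj.
(* The optimal dual value is the theta number of G, so [mycielski_root l] is the formula of the
   statement. *)
have thetaG : theta_bar R G = l.
  apply/eqP; rewrite eq_le (theta_bar_le hG repG) /=; apply: theta_bar_ge.
    by have [t Gt _] := theta_bar_values_scaled_rep hG repG; exists t.
  exact: (scaled_rep_ge l1 psdA Apsi psi1 supA A1).
have hM : (0 < #|mycielskian G|)%N by apply/card_gt0P; exists None.
have [w repM] := mycielskian_scaled_rep l1 yy yadj.
rewrite thetaG -/(mycielski_root l) addrC.
apply/eqP; rewrite eq_le (theta_bar_le hM repM) /=; apply: theta_bar_ge.
  by have [t Mt _] := theta_bar_values_scaled_rep hM repM; exists t.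
exact: (mycielskian_rep_ge l1 psdA Ale Apsi psi1 supA A1).
Qed.
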